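(* Let $\nu,\tilde\nu \ge 2$ and let $C \subset \mathbb{R}^n$ be a compact convex set. Let $f_1,\dots,f_k : C^o \to \mathbb{R}$ be $C^3$ functions satisfying the barrier conditions with parameter $\nu$ on $C$, and let $f_c$ be a convex combination of $f_1,\dots,f_k$. Suppose that $P_{\tilde\nu}$ contains the convex hull of $P_{\nu}$. Then $f_c$ satisfies the barrier conditions with parameter $\tilde\nu$ on $C$.
   Context: $C^o$ denotes the interior of $C$. For $\nu\ge 2$ put $\gamma = \frac{\nu-2}{\sqrt{\nu-1}}$. Barrier conditions with parameter $\nu$ on $C$: a $C^3$ function $f: C^o\to\mathbb{R}$ satisfies them if (1) $f''(x) - f'(x)\otimes f'(x) \succ 0$ for all $x\in C^o$; (2) $\lim_{x\to\partial C} f(x) = +\infty$; (3) $|f'''(x)[v,v,v] - 6f''(x)[v,v]f'(x)[v] + 4(f'(x)[v])^3| \le 2\gamma\,(f''(x)[v,v] - (f'(x)[v])^2)^{3/2}$ for all $x\in C^o$ and all vectors $v\in\mathbb{R}^n$. The set $P_\nu \subset \mathbb{R}^3$ is the set of all $(x_1,x_2,x_3)$ with $x_2 \ge x_1^2$ such that for both choices of the sign $$\frac{\sqrt{x_2-x_1^2}}{\sqrt{\nu-1}} \le \pm x_1 + 1 \le \sqrt{\nu-1}\,\sqrt{x_2-x_1^2},$$ and $$|x_3 - 6x_2x_1 + 4x_1^3| \le 2\,\frac{\nu-2}{\sqrt{\nu-1}}\,(x_2-x_1^2)^{3/2}.$$ *)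

(* Defs.v *)
(* MathComp-Analysis *)
From mathcomp Require Import all_boot all_order all_algebra.
From mathcomp Require Import all_classical all_reals all_analysis.

Set Implicit Arguments.
Unset Strict Implicit.
Unset Printing Implicit Defensive.

Import Order.TTheory GRing.Theory Num.Theory.
Import numFieldNormedType.Exports.

Local Open Scope classical_set_scope.
Local Open Scope ring_scope.

(* Functions on a subset of R^n are represented by total functions; every
   notion below only depends on their values on the open set in question. *)

Section derivatives.
Context {R : realType} {n : nat}.
Implicit Types (f : 'rV[R]_n -> R) (x u v w : 'rV[R]_n).

(* Frechet derivatives evaluated at vectors:
   f'(x)[u], f''(x)[u, v] and f'''(x)[u, v, w]. *)
Definition D1 f x u : R := 'd f x u.
Definition D2 f x u v : R := 'd (fun y => D1 f y u) x v.
Definition D3 f x u v w : R := 'd (fun y => D2 f y u v) x w.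

(* f is C^k on the open set U. As R^n is finite-dimensional, f' is C^(k-1) as a
   map into the space of linear forms iff all evaluations f'(.)[v] are. *)
Fixpoint Ck (k : nat) (U : set 'rV[R]_n) f : Prop :=
  if k is k'.+1 then
    (forall x, U x -> differentiable f x) /\ (forall v, Ck k' U (D1 f ^~ v))
  else forall x, U x -> {for x, continuous f}.

(* Used for symmetric bilinear forms only. *)
Definition posdef (B : 'rV[R]_n -> 'rV[R]_n -> R) : Prop :=
  forall v, v != 0 -> 0 < B v v.

End derivatives.

Definition boundary {T : topologicalType} (A : set T) : set T :=
  closure A `\` A°.

Definition barrier_gamma {R : realType} (nu : R) : R :=
  (nu - 2) / Num.sqrt (nu - 1).

Definition barrier_conditions {R : realType} {n : nat} (nu : R)
    (C : set 'rV[R]_n) (f : 'rV[R]_n -> R) : Prop :=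
  [/\ Ck 3 C° f,
      forall x, C° x -> posdef (fun u v => D2 f x u v - D1 f x u * D1 f x v),
      forall p, boundary C p -> f x @[x --> within C° (nbhs p)] --> +oo
    & forall x, C° x -> forall v,
        `|D3 f x v v v - 6 * D2 f x v v * D1 f x v + 4 * D1 f x v ^+ 3|
          <= 2 * barrier_gamma nu * (D2 f x v v - D1 f x v ^+ 2) `^ (3 / 2)].

Definition Pset {R : realType} (nu : R) : set 'rV[R]_3 :=
  [set p | let x1 := p 0 0 in let x2 := p 0 1 in let x3 := p 0 2 in
    let s := Num.sqrt (x2 - x1 ^+ 2) in
    [/\ x1 ^+ 2 <= x2,
        s / Num.sqrt (nu - 1) <= x1 + 1 <= Num.sqrt (nu - 1) * s,
        s / Num.sqrt (nu - 1) <= - x1 + 1 <= Num.sqrt (nu - 1) * s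
      & `|x3 - 6 * x2 * x1 + 4 * x1 ^+ 3|
          <= 2 * ((nu - 2) / Num.sqrt (nu - 1)) * (x2 - x1 ^+ 2) `^ (3 / 2)]].

Definition convex_hull {R : realType} {V : lmodType R} (A : set V) : set V :=
  smallest (@convex_set R V) A.

Definition convex_combination_on {R : realType} {T : Type} {k : nat}
    (U : set T) (f : 'I_k -> T -> R) (g : T -> R) : Prop :=
  exists lambda : 'I_k -> R,
    [/\ forall i, 0 <= lambda i,
        \sum_(i < k) lambda i = 1
      & forall x, U x -> g x = \sum_(i < k) lambda i * f i x].

(* Main.v *)
(* Restrict the functions to a line through x with direction v, which leaves
   C° at times - p and q. The barrier conditions give a Riccati differential
   inequality along the line, and blow-up at the exit times forces s / be <= 1
   / q - f'(x)[v] <= be s and s / be <= 1 / p + f'(x)[v] <= be s, where s^2 =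
   f''(x)[v, v] - f'(x)[v]^2 and be = sqrt (nu - 1). A projective change of
   parameter moves the exit times to -1 and 1; it acts affinely on the three
   derivatives of f along the line, and the bounds together with the third
   barrier condition then say that their images form a point of P_nu. The
   change of parameter depends only on p and q, hence is common to all f_i, so
   the point of the convex combination is in the convex hull of P_nu. *)
Require Import Defs.
From mathcomp Require Import all_boot all_order all_algebra.
From mathcomp Require Import all_classical all_reals all_analysis.
From mathcomp Require Import ring lra.

Set Implicit Arguments.
Unset Strict Implicit.
Unset Printing Implicit Defensive.

Import Order.TTheory GRing.Theory Num.Theory.
Import numFieldNormedType.Exports.

Local Open Scope classical_set_scope.
Local Open Scope ring_scope.

(** * Monotonicity from the sign of a derivative *)

Lemma is_derive_le0_nonincr (R : realType) (f df : R -> R) (a b : R) :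
  a <= b -> (forall t, a <= t <= b -> is_derive t 1 f (df t)) ->
  (forall t, a < t < b -> df t <= 0) -> f b <= f a.
Proof.
rewrite le_eqVlt => /predU1P[-> //|ab] fd d0.
have [||c] := @MVT R f df a b ab.
- by move=> x; rewrite in_itv /= => /andP[ax xb]; apply: fd; rewrite !ltW.
- apply: derivable_within_continuous => x; rewrite in_itv /= => xab.
  by have := fd x xab; case.
rewrite in_itv /= => cab fE.
by rewrite -subr_le0 fE mulr_le0_ge0 ?d0 // subr_ge0 ltW.
Qed.

Lemma is_derive_ge0_nondecr (R : realType) (f df : R -> R) (a b : R) :
  a <= b -> (forall t, a <= t <= b -> is_derive t 1 f (df t)) ->
  (forall t, a < t < b -> 0 <= df t) -> f a <= f b.
Proof.
move=> ab fd d0; rewrite -lerN2.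
apply: (@is_derive_le0_nonincr _ (fun t => - f t) (fun t => - df t)) => //.
- by move=> t tab; apply: is_deriveN; apply: fd.
- by move=> t tab; rewrite oppr_le0 d0.
Qed.

(** The sign of [dz] is known only while [z] is negative, so a first-crossing argument is needed:
    before the first time with [0 <= z] the function is nonincreasing, hence still at most [z 0 < 0]
    at that time. It serves to propagate a failed bound along a line. *)
Lemma negative_nonincr (R : realType) (z dz : R -> R) (t1 : R) : 0 <= t1 ->
  (forall t, 0 <= t <= t1 -> is_derive t 1 z (dz t)) ->
  (forall t, 0 <= t <= t1 -> z t < 0 -> dz t <= 0) ->
  z 0 < 0 -> z t1 <= z 0.
Proof.
move=> t1_ge0 zd dz_le0 z0_lt0.
suff z_lt0 t : 0 <= t <= t1 -> z t < 0.
  apply: (is_derive_le0_nonincr t1_ge0 zd) => t /andP[t0 tt1].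
  by apply: dz_le0; [|apply: z_lt0]; rewrite !ltW.
move=> /andP[t_ge0 tt1]; rewrite ltNge; apply/negP => zt_ge0.
pose S := [set s | 0 <= s <= t /\ 0 <= z s].
have St : S t by split; rewrite ?t_ge0 ?lexx.
have lbS : lbound S 0 by move=> s [/andP[]].
have hasS : has_inf S by split; [exists t|exists 0].
have tau_ge0 : 0 <= inf S by apply: lb_le_inf => //; exists t.
have tau_le : inf S <= t by apply: ge_inf => //; exists 0.
have tau_t1 : inf S <= t1 by apply: le_trans tt1.
have before s : 0 <= s -> s < inf S -> z s < 0.
  move=> s0 sinf; rewrite ltNge; apply/negP => zs.
  have : inf S <= s.
    apply: ge_inf; [by exists 0|split=> //].
    by rewrite s0 (le_trans (ltW sinf)).
  by rewrite leNgt sinf.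
(* By continuity [z < 0] would persist to the right of [inf S], where points of [S] accumulate. *)
have ztau : 0 <= z (inf S).
  rewrite leNgt; apply/negP => ztau.
  have zc : {for inf S, continuous z}.
    apply/differentiable_continuous/derivable1_diffP.
    by have := zd (inf S); rewrite tau_ge0 tau_t1 => /(_ isT); case.
  have /nbhs_ballP[e /= e0 He] : \forall s \near inf S, z s < 0.
    exact: (@cvgr_lt _ _ _ _ z (z (inf S)) zc 0 ztau).
  have [s Ss sinf] := inf_adherent e0 hasS.
  have sge : inf S <= s by apply: ge_inf => //; exists 0.
  have : z s < 0.
    by apply: He; rewrite /ball /= distrC ger0_norm ?subr_ge0 // ltrBlDl.
  by case: Ss => _; rewrite leNgt => /negP.
have : z (inf S) <= z 0.
  apply: (@is_derive_le0_nonincr _ z dz) => //.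
    by move=> s /andP[s0 sS]; apply: zd; rewrite s0 (le_trans sS).
  move=> s /andP[s0 sS]; apply: dz_le0; last by apply: before => //; exact: ltW.
  by rewrite ltW // (le_trans (ltW sS)).
by rewrite leNgt (lt_le_trans z0_lt0 ztau).
Qed.

Lemma is_derive_lt0_decr (R : realType) (f df : R -> R) (a b : R) :
  a < b -> (forall t, a <= t <= b -> is_derive t 1 f (df t)) ->
  (forall t, a < t < b -> df t < 0) -> f b < f a.
Proof.
move=> ab fd d0; have [||c] := @MVT R f df a b ab.
- by move=> x; rewrite in_itv /= => /andP[ax xb]; apply: fd; rewrite !ltW.
- apply: derivable_within_continuous => x; rewrite in_itv /= => xab.
  by have := fd x xab; case.
rewrite in_itv /= => cab fE.
by rewrite -subr_lt0 fE pmulr_llt0 ?subr_gt0 // d0.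
Qed.

(** * Differentiation rules for real functions, in a form that composes by application *)

Section pointwise_derivatives.
Context {R : realType}.
Implicit Types (f g : R -> R) (df dg t : R).

Lemma is_derive_fun_eq f df df' t :
  is_derive t 1 f df' -> df' = df -> is_derive t 1 f df.
Proof. by move=> ? <-. Qed.

Lemma is_derive_fun_cst (k t : R) : is_derive t 1 (fun=> k) 0.
Proof. exact: (is_derive_cst (k : R^o) (t : R^o) 1). Qed.

Lemma is_derive_fun_id t : is_derive t 1 (fun x => x) 1.
Proof. exact: (is_derive_id (t : R^o) 1). Qed.

Lemma is_derive_fun_add f g df dg t :
  is_derive t 1 f df -> is_derive t 1 g dg ->
  is_derive t 1 (fun x => f x + g x) (df + dg).
Proof. by move=> ? ?; apply: is_deriveD. Qed.

Lemma is_derive_fun_opp f df t :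
  is_derive t 1 f df -> is_derive t 1 (fun x => - f x) (- df).
Proof. by move=> ?; apply: is_deriveN. Qed.

Lemma is_derive_fun_mul f g df dg t :
  is_derive t 1 f df -> is_derive t 1 g dg ->
  is_derive t 1 (fun x => f x * g x) (df * g t + f t * dg).
Proof.
move=> fd gd; apply: (@is_derive_eq _ _ _ _ _ _ _ _ (is_deriveM fd gd)).
by rewrite /GRing.scale /=; ring.
Qed.

Lemma is_derive_fun_inv f df t : f t != 0 ->
  is_derive t 1 f df -> is_derive t 1 (fun x => (f x)^-1) (- df / f t ^+ 2).
Proof.
move=> f0 fd; apply: (@is_derive_eq _ _ _ _ _ _ _ _ (is_deriveV f0 fd)).
by rewrite /GRing.scale /=; field.
Qed.

Lemma is_derive_fun_exp f df t :
  is_derive t 1 f df -> is_derive t 1 (fun x => expR (f x)) (expR (f t) * df).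
Proof. by move=> fd; apply: is_derive1_comp. Qed.

Lemma is_derive_fun_sqrt f df t : 0 < f t ->
  is_derive t 1 f df ->
  is_derive t 1 (fun x => Num.sqrt (f x)) ((2 * Num.sqrt (f t))^-1 * df).
Proof.
move=> f0 fd; apply: (@is_derive1_comp _ Num.sqrt f t) => //.
exact: is_derive1_sqrt.
Qed.

End pointwise_derivatives.

(** * Riccati inequality up to the exit time *)

(* For g t = f (x + t v) the data are a = g', s = sqrt (g'' - g'^2) and
   u = exp (- g); q is the exit time.  The ratio y is - g' / sqrt (g'' - g'^2)
   for the function obtained from g by the projective change of parameter
   1 / (q - t), which sends q to infinity. *)
Section exit_time_riccati.
Context {R : realType} {q gam : R} {a s e u : R -> R}.
Hypothesis gam_ge0 : 0 <= gam.
Hypothesis q_gt0 : 0 < q.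
Hypothesis s_gt0 : forall t : R, 0 <= t < q -> 0 < s t.
Hypothesis u_gt0 : forall t : R, 0 <= t < q -> 0 < u t.
Hypothesis e_le : forall t : R, 0 <= t < q -> `|e t| <= gam.
Hypothesis da :
  forall t : R, 0 <= t < q -> is_derive t 1 a (s t ^+ 2 + a t ^+ 2).
Hypothesis ds : forall t : R, 0 <= t < q ->
  is_derive t 1 s (2 * a t * s t + e t * s t ^+ 2).
Hypothesis du : forall t : R, 0 <= t < q -> is_derive t 1 u (- a t * u t).
Hypothesis u_to0 : forall eps : R, 0 < eps ->
  exists2 t0, t0 < q & forall t : R, t0 < t < q -> u t < eps.

Let d (t : R) := q - t.
Let r (t : R) := (d t)^-1 - a t.
Let y (t : R) := r t / s t.
(** The derivative of [u / d] with respect to the new parameter [1 / d]; see [dud]. *)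
Let w (t : R) := u t * d t * r t.

Let d_gt0 (t : R) : 0 <= t < q -> 0 < d t.
Proof. by case/andP=> _; rewrite subr_gt0. Qed.

Let dd (t : R) : is_derive t 1 d (- 1).
Proof.
apply: (is_derive_fun_eq (is_derive_fun_add (is_derive_fun_cst q t)
  (is_derive_fun_opp (is_derive_fun_id t)))).
by rewrite add0r.
Qed.

Let dVd (t : R) : 0 <= t < q -> is_derive t 1 (fun x => (d x)^-1) ((d t)^-1 ^+ 2).
Proof.
move=> tq; have dn0 : d t != 0 by rewrite gt_eqF ?d_gt0.
apply: (is_derive_fun_eq (is_derive_fun_inv dn0 (dd t))).
by rewrite opprK div1r exprVn.
Qed.

Let dr (t : R) : 0 <= t < q ->
  is_derive t 1 r ((d t)^-1 ^+ 2 - (s t ^+ 2 + a t ^+ 2)).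
Proof.
move=> tq; exact: is_derive_fun_add (dVd tq) (is_derive_fun_opp (da tq)).
Qed.

(** The Riccati equation. Since [|e| <= gam], the right-hand side is negative when
    [y ^+ 2 + gam * y < 1] and positive when [y > gam + y^-1], given [y > 0]: a violated bound only
    gets worse. *)
Let dy (t : R) : 0 <= t < q -> is_derive t 1 y (s t * (y t ^+ 2 - e t * y t - 1)).
Proof.
move=> tq; have s0 := s_gt0 tq; have d0 := d_gt0 tq.
have sn0 : s t != 0 by rewrite gt_eqF.
apply: (is_derive_fun_eq
  (is_derive_fun_mul (dr tq) (is_derive_fun_inv sn0 (ds tq)))).
by rewrite /y /r /=; field; rewrite sn0 gt_eqF.
Qed.

Let dw (t : R) : 0 <= t < q -> is_derive t 1 w (- (s t ^+ 2 * u t * d t)).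
Proof.
move=> tq; have d0 := d_gt0 tq.
apply: (is_derive_fun_eq
  (is_derive_fun_mul (is_derive_fun_mul (du tq) (dd t)) (dr tq))).
by rewrite /= /r /=; field; rewrite gt_eqF.
Qed.

Let dud (t : R) : 0 <= t < q ->
  is_derive t 1 (fun x => u x / d x) (w t * (d t)^-1 ^+ 2).
Proof.
move=> tq; have d0 := d_gt0 tq.
apply: (is_derive_fun_eq (is_derive_fun_mul (du tq) (dVd tq))).
by rewrite /w /r /=; field; rewrite gt_eqF.
Qed.

Let subint (t1 t2 t : R) : 0 <= t1 -> t2 < q -> t1 <= t <= t2 -> 0 <= t < q.
Proof.
by move=> t10 t2q /andP[t1t tt2]; rewrite (le_trans t10) // (le_lt_trans tt2).
Qed.

Let late (t1 K : R) : 0 <= t1 < q -> exists2 t, t1 <= t < q & K < (d t)^-1.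
Proof.
move=> /[dup] t1q /andP[t10 t1_lt]; have d0 := d_gt0 t1q.
pose M := `|K| + 1 + (d t1)^-1.
have dV0 : 0 < (d t1)^-1 by rewrite invr_gt0.
have M0 : 0 < M by rewrite /M; have := normr_ge0 K; lra.
exists (q - M^-1).
  rewrite ltrBlDr ltrDl invr_gt0 M0 andbT.
  rewrite lerBrDr -lerBrDl -/(d t1) -[leRHS]invrK lef_pV2 ?posrE //.
  by rewrite /M; have := normr_ge0 K; lra.
rewrite /d subKr invrK /M; have := ler_norm K; lra.
Qed.

(* Otherwise the concave function u would become negative before q. *)
Let w_gt0 (t : R) : 0 <= t < q -> 0 < w t.
Proof.
(* [w] decreases strictly, so nonnegativity at the later time [(t + q) / 2] gives positivity at
   [t]. *)
suff w_ge0 t' : 0 <= t' < q -> 0 <= w t'.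
  move=> /[dup] tq /andP[t0 t_lt].
  have mid : t < (t + q) / 2 by lra.
  have mid2 : (t + q) / 2 < q by lra.
  apply: le_lt_trans (w_ge0 ((t + q) / 2) _) _; first by apply/andP; split; lra.
  apply: (is_derive_lt0_decr mid (df := fun t => - (s t ^+ 2 * u t * d t))).
    by move=> t' t'P; apply: dw; exact: subint t'P.
  move=> t' /andP[t'1 t'2].
  have t'q : 0 <= t' < q by apply/andP; split; lra.
  by rewrite oppr_lt0 !mulr_gt0 ?exprn_gt0 ?s_gt0 ?u_gt0 ?d_gt0.
move=> /[dup] tq /andP[t0 t_lt]; rewrite leNgt; apply/negP => wneg.
(* As a function of [1 / d], [u / d] has slope at most [w t' < 0] after [t']; by time [t2] the
   parameter [1 / d] has grown enough to make [u / d] negative. *)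
have [t2 /andP[t't2 t2q] big] := late (u t' / d t' / (- w t') + (d t')^-1) tq.
have w0 : 0 < - w t' by rewrite oppr_gt0.
have wle x : t' <= x < q -> w x <= w t'.
  move=> /andP[tx xq].
  apply: (@is_derive_le0_nonincr _ w (fun t => - (s t ^+ 2 * u t * d t))) => //.
    by move=> z zP; apply: dw; exact: subint zP.
  move=> z /andP[z1 z2].
  have zq : 0 <= z < q by apply/andP; split; lra.
  by rewrite oppr_le0 ltW // !mulr_gt0 ?exprn_gt0 ?s_gt0 ?u_gt0 ?d_gt0.
have : u t2 / d t2 + (- w t') * (d t2)^-1 <= u t' / d t' + (- w t') * (d t')^-1.
  apply: (@is_derive_le0_nonincr _ (fun x => u x / d x + (- w t') * (d x)^-1)
    (fun x => w x * (d x)^-1 ^+ 2 + (0 * (d x)^-1 + (- w t') * (d x)^-1 ^+ 2))).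
  - exact: t't2.
  - move=> x xP; have xq := subint t0 t2q xP.
    exact: is_derive_fun_add (dud xq)
      (is_derive_fun_mul (is_derive_fun_cst _ x) (dVd xq)).
  - move=> x /andP[x1 x2]; rewrite mul0r add0r -mulrDl mulr_le0_ge0 ?sqr_ge0 //.
    by rewrite subr_le0 wle // (ltW x1) (lt_trans x2).
have ud0 : 0 < u t2 / d t2.
  have t2q' : 0 <= t2 < q by rewrite t2q (le_trans t0).
  by rewrite divr_gt0 ?u_gt0 ?d_gt0.
move: big; rewrite -ltrBrDr ltr_pdivrMr // mulrBl => big; lra.
Qed.

Let r_gt0 (t : R) : 0 <= t < q -> 0 < r t.
Proof.
move=> tq; have := w_gt0 tq.
by rewrite /w pmulr_rgt0 // mulr_gt0 ?u_gt0 ?d_gt0.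
Qed.

Let y_gt0 (t : R) : 0 <= t < q -> 0 < y t.
Proof. by move=> tq; rewrite divr_gt0 ?r_gt0 ?s_gt0. Qed.

Let zero_in : (0 : R) <= 0 < q.
Proof. by rewrite lexx. Qed.

Let e_bound (t : R) : 0 <= t < q -> - gam <= e t <= gam.
Proof. by move=> /e_le; rewrite ler_norml. Qed.

(* If the inequality fails at 0, it fails with a margin on [0, q[; then
   exp (k y) / (s d^2) + 1 / d is nonincreasing, although 1 / d is unbounded. *)
Let y0_ge : 1 <= y 0 ^+ 2 + gam * y 0.
Proof.
rewrite leNgt; apply/negP => neg.
pose kap := 1 - (y 0 ^+ 2 + gam * y 0).
have kap0 : 0 < kap by rewrite /kap; lra.
(* The margin persists: [y ^+ 2 + gam * y - 1] is nonincreasing as long as it is negative. *)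
have quad (t : R) : 0 <= t < q -> y t ^+ 2 + gam * y t - 1 <= - kap.
  move=> /andP[t0 tq].
  pose Y x := s x * (y x ^+ 2 - e x * y x - 1).
  have := @negative_nonincr _ (fun x => y x * y x + gam * y x + (- 1))
    (fun x => (Y x * y x + y x * Y x + (0 * y x + gam * Y x)) + 0) t t0.
  rewrite -!expr2 /kap => zle.
  suff : y t ^+ 2 + gam * y t - 1 <= y 0 ^+ 2 + gam * y 0 - 1 by lra.
  apply: zle; last by lra.
  - move=> x xP; have xq := subint (lexx 0) tq xP.
    exact: is_derive_fun_add (is_derive_fun_add (is_derive_fun_mul (dy xq) (dy xq))
      (is_derive_fun_mul (is_derive_fun_cst gam x) (dy xq))) (is_derive_fun_cst (- 1) x).
  - move=> x xP; have xq := subint (lexx 0) tq xP.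
    have y0 := y_gt0 xq; have s0 := s_gt0 xq; have /andP[e1 e2] := e_bound xq.
    rewrite -expr2 => zneg.
    have -> : Y x * y x + y x * Y x + (0 * y x + gam * Y x) + 0
      = (2 * y x + gam) * s x * (y x ^+ 2 - e x * y x - 1) by rewrite /Y; ring.
    rewrite mulr_ge0_le0 //.
      by rewrite mulr_ge0 // ?(ltW s0) //; lra.
    have : (- gam) * y x <= e x * y x by rewrite ler_wpM2r // ltW.
    lra.
(* With [y <= 1] and [- e <= gam], the term [2 * y - e] is at most [2 + gam]; this [k] then makes
   [k * (y ^+ 2 - e * y - 1) + (2 * y - e)] at most -1, which offsets the derivative of [1 / d]. *)
pose k := (3 + gam) / kap.
(* The reciprocal of [sqrt (g'' - g'^2)] after the change of parameter; its derivative with respect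
   to [1 / d] is [2 * y - e]. *)
pose h x := (s x)^-1 * ((d x)^-1 * (d x)^-1).
have dh (t : R) : 0 <= t < q ->
    is_derive t 1 h (h t * (s t * (2 * y t - e t))).
  move=> tq; have s0 := s_gt0 tq; have d0 := d_gt0 tq.
  have sn0 : s t != 0 by rewrite gt_eqF.
  apply: (is_derive_fun_eq (is_derive_fun_mul (is_derive_fun_inv sn0 (ds tq))
    (is_derive_fun_mul (dVd tq) (dVd tq)))).
  by rewrite /h /y /r /=; field; rewrite sn0 gt_eqF.
pose H x := expR (k * y x) * h x + (d x)^-1.
have [t /andP[t0 tq] late_t] := late (H 0) zero_in.
have : H t <= H 0.
  apply: (@is_derive_le0_nonincr _ H (fun x =>
    (expR (k * y x) * (0 * y x + k * (s x * (y x ^+ 2 - e x * y x - 1)))) * h x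
     + expR (k * y x) * (h x * (s x * (2 * y x - e x))) + (d x)^-1 ^+ 2)); first exact: t0.
    move=> x xP; have xq := subint (lexx 0) tq xP.
    exact: is_derive_fun_add (is_derive_fun_mul (is_derive_fun_exp
      (is_derive_fun_mul (is_derive_fun_cst k x) (dy xq))) (dh x xq)) (dVd xq).
  move=> x /andP[x0 xt]; have xq : 0 <= x < q by rewrite ltW //= (lt_trans xt).
  have y0 := y_gt0 xq; have s0 := s_gt0 xq; have /andP[e1 e2] := e_bound xq.
  have d0 := d_gt0 xq.
  have -> : expR (k * y x) * (0 * y x + k * (s x * (y x ^+ 2 - e x * y x - 1))) * h x
     + expR (k * y x) * (h x * (s x * (2 * y x - e x))) + (d x)^-1 ^+ 2
   = (d x)^-1 ^+ 2 * (1 + expR (k * y x) *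
       (k * (y x ^+ 2 - e x * y x - 1) + (2 * y x - e x))).
    by rewrite /h; field; rewrite !gt_eqF.
  rewrite mulr_ge0_le0 ?sqr_ge0 //.
  have qx := quad x xq.
  have k0 : 0 < k by rewrite divr_gt0 //; lra.
  have kk : k * kap = 3 + gam by rewrite /k divfK ?gt_eqF.
  have ey : (- gam) * y x <= e x * y x by rewrite ler_wpM2r // ltW.
  have gy : 0 <= gam * y x by rewrite mulr_ge0 // ltW.
  have y1 : y x <= 1.
    rewrite leNgt; apply/negP => y1.
    have : 1 < y x ^+ 2 by rewrite exprn_egt1.
    lra.
  have kq : k * (y x ^+ 2 - e x * y x - 1) <= k * (- kap).
    by rewrite ler_wpM2l ?(ltW k0) //; lra.
  have E1 : 1 <= expR (k * y x).
    by rewrite -expR0 ler_expR mulr_ge0 ?ltW.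
  have : expR (k * y x) * (k * (y x ^+ 2 - e x * y x - 1) + (2 * y x - e x))
    <= expR (k * y x) * (- 1).
    rewrite ler_wpM2l ?(le_trans _ E1) //; lra.
  lra.
have tq' : 0 <= t < q by rewrite t0.
have : 0 < expR (k * y t) * h t.
  by rewrite !mulr_gt0 ?expR_gt0 ?invr_gt0 ?d_gt0 ?s_gt0.
rewrite {1}/H; lra.
Qed.

(* If the inequality fails at 0, it fails with a margin on [0, q[; then w is
   bounded below by a positive constant, which keeps u from tending to 0. *)
Let y0_le : y 0 <= gam + (y 0)^-1.
Proof.
rewrite leNgt; apply/negP => neg.
pose kap := y 0 - (gam + (y 0)^-1).
have kap0 : 0 < kap by rewrite /kap; lra.
pose Y x := s x * (y x ^+ 2 - e x * y x - 1).
have YE (x : R) : 0 <= x < q -> Y x = s x * y x * (y x - e x - (y x)^-1).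
  by move=> /y_gt0 y0; rewrite /Y; field; rewrite gt_eqF.
have dyV (x : R) : 0 <= x < q -> is_derive x 1 (fun x => (y x)^-1) (- Y x / y x ^+ 2).
  move=> xq; have yn0 : y x != 0 by rewrite gt_eqF ?y_gt0.
  exact: is_derive_fun_inv yn0 (dy xq).
(* Again the margin persists: while [gam + y^-1 - y] is negative, [y] is nondecreasing. *)
have ygap (t : R) : 0 <= t < q -> gam + (y t)^-1 - y t <= - kap.
  move=> /andP[t0 tq].
  have := @negative_nonincr _ (fun x => gam + (y x)^-1 + - y x)
    (fun x => 0 + (- Y x / y x ^+ 2) + - Y x) t t0.
  rewrite /kap => zle.
  suff : gam + (y t)^-1 - y t <= gam + (y 0)^-1 - y 0 by lra.
  apply: zle; last by lra.
  - move=> x xP; have xq := subint (lexx 0) tq xP.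
    exact: is_derive_fun_add (is_derive_fun_add (is_derive_fun_cst gam x)
      (dyV x xq)) (is_derive_fun_opp (dy xq)).
  - move=> x xP; have xq := subint (lexx 0) tq xP.
    have y0 := y_gt0 xq; have s0 := s_gt0 xq; have /andP[e1 e2] := e_bound xq.
    move=> zneg.
    have Y0 : 0 <= Y x.
      rewrite YE // mulr_ge0 //; first by rewrite mulr_ge0 // ltW.
      lra.
    by rewrite add0r mulNr -opprD oppr_le0 addr_ge0 // divr_ge0 // sqr_ge0.
(* The derivative of [Q] has the sign of [k * (y - e - y^-1) - 1], which the margin [kap] makes
   nonnegative for this [k]. The exponential factor is at most 1, so [Q 0] bounds [w] from below. *)
pose k := kap^-1.
pose Q x := w x * expR (- (k * (y x)^-1)).
have E_gt0 (x : R) : 0 < expR (- (k * (y x)^-1)) by exact: expR_gt0.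
have A0 : 0 < Q 0 by rewrite mulr_gt0 ?w_gt0.
have wA (t : R) : 0 <= t < q -> Q 0 <= w t.
  move=> /[dup] tq' /andP[t0 tq].
  apply: (@le_trans _ _ (Q t)); last first.
    rewrite /Q ler_piMr ?ltW ?w_gt0 // -expR0 ltr_expR oppr_lt0.
    by rewrite mulr_gt0 ?invr_gt0 ?y_gt0.
  apply: (@is_derive_ge0_nondecr _ Q (fun x =>
    - (s x ^+ 2 * u x * d x) * expR (- (k * (y x)^-1))
    + w x * (expR (- (k * (y x)^-1)) * - (0 * (y x)^-1 + k * (- Y x / y x ^+ 2))))) => //.
    move=> x xP; have xq := subint (lexx 0) tq xP.
    exact: is_derive_fun_mul (dw xq) (is_derive_fun_exp (is_derive_fun_opp
      (is_derive_fun_mul (is_derive_fun_cst k x) (dyV x xq)))).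
  move=> x /andP[x0 xt]; have xq : 0 <= x < q by rewrite ltW //= (lt_trans xt).
  have y0 := y_gt0 xq; have s0 := s_gt0 xq; have /andP[e1 e2] := e_bound xq.
  have d0 := d_gt0 xq; have u0 := u_gt0 xq.
  have rE : r x = y x * s x by rewrite /y divfK // gt_eqF.
  have -> : - (s x ^+ 2 * u x * d x) * expR (- (k * (y x)^-1))
      + w x * (expR (- (k * (y x)^-1)) * - (0 * (y x)^-1 + k * (- Y x / y x ^+ 2)))
    = s x ^+ 2 * u x * d x * expR (- (k * (y x)^-1))
      * (k * (y x - e x - (y x)^-1) - 1).
    by rewrite /w rE YE //; field; rewrite gt_eqF.
  rewrite mulr_ge0 //.
    by rewrite ltW // !mulr_gt0 // exprn_gt0.
  have kk : k * kap = 1 by rewrite /k mulVf ?gt_eqF.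
  have : k * kap <= k * (y x - e x - (y x)^-1).
    rewrite ler_wpM2l ?invr_ge0 ?(ltW kap0) //.
    have := ygap x xq; lra.
  lra.
set A := Q 0 in A0 wA.
pose K := u 0 / d 0 + (- A) * (d 0)^-1.
(* Integrating [w >= A] in the parameter [1 / d] gives [u >= K * d + A], incompatible with
   [u < A / 2] close to [q]. *)
have uK (t : R) : 0 <= t < q -> K <= u t / d t + (- A) * (d t)^-1.
  move=> /andP[t0 tq]; apply: (@is_derive_ge0_nondecr _
    (fun x => u x / d x + (- A) * (d x)^-1)
    (fun x => w x * (d x)^-1 ^+ 2 + (0 * (d x)^-1 + (- A) * (d x)^-1 ^+ 2))) => //.
  - move=> x xP; have xq := subint (lexx 0) tq xP.
    exact: is_derive_fun_add (dud xq)
      (is_derive_fun_mul (is_derive_fun_cst _ x) (dVd xq)).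
  - move=> x /andP[x1 x2]; rewrite mul0r add0r -mulrDl mulr_ge0 ?sqr_ge0 //.
    by rewrite subr_ge0 wA // ltW //= (lt_trans x2).
have A20 : 0 < A / 2 by rewrite divr_gt0.
have [t0 t0q ut0] := u_to0 A20.
(* The midpoint keeps the chosen time strictly after [t0]; the maximum with 0 keeps it in the
   domain. *)
have t1q : 0 <= Num.max 0 ((t0 + q) / 2) < q.
  by rewrite le_max lexx /= gt_max q_gt0 /=; lra.
have [t /andP[+ tq]] := late ((`|K| + 1) / (A / 2)) t1q.
rewrite ge_max => /andP[tge0 tge].
have tq' : 0 <= t < q by rewrite tge0.
have dV0 : 0 < (d t)^-1 by rewrite invr_gt0 d_gt0.
rewrite ltr_pdivrMr // => big.
have ulow := uK t tq'.
have uhigh : u t / d t < A / 2 / d t.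
  by rewrite ltr_pM2r // ut0 // tq andbT; lra.
have := ler_norm (- K); rewrite normrN.
lra.
Qed.

(** For [gam = bet - bet^-1] the quadratics behind [y0_ge] and [y0_le] factor, with positive roots
    [bet^-1] and [bet]; hence [y 0] lies between these, and [q^-1 - a 0 = y 0 * s 0]. *)
Lemma riccati_exit_bounds (bet : R) : 0 < bet -> gam = bet - bet^-1 ->
  s 0 / bet <= q^-1 - a 0 <= bet * s 0.
Proof.
move=> b0 gE; have s0 := s_gt0 zero_in; have yp := y_gt0 zero_in.
have rE : q^-1 - a 0 = y 0 * s 0 by rewrite /y /r /d subr0 divfK // gt_eqF.
have bV0 : 0 < bet^-1 by rewrite invr_gt0.
rewrite rE mulrC !ler_pM2r //; apply/andP; split.
  rewrite -subr_ge0 -(pmulr_rge0 _ (addr_gt0 yp b0)).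
  have -> : (y 0 + bet) * (y 0 - bet^-1) = y 0 ^+ 2 + gam * y 0 - 1.
    by rewrite gE; field; rewrite gt_eqF.
  by rewrite subr_ge0.
rewrite -subr_le0 -(pmulr_rle0 _ (addr_gt0 yp bV0)).
have -> : (y 0 + bet^-1) * (y 0 - bet) = y 0 * (y 0 - (gam + (y 0)^-1)).
  by rewrite gE; field; rewrite !gt_eqF.
by rewrite pmulr_rle0 // subr_le0.
Qed.

End exit_time_riccati.

(** * Exit times of lines from a bounded open set *)

Lemma continuous_line (R : realType) (V : normedModType R) (x v : V) :
  continuous (fun t : R => x + t *: v).
Proof.
by move=> t; apply: cvgD; [exact: cvg_cst|exact: scalel_continuous].
Qed.

(** The exit time is the infimum of the times outside [U]: boundedness makes this set nonempty, and
    openness puts the infimum itself outside [U]. *)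
Lemma exit_time_exists (R : realType) (V : normedModType R) (U : set V)
    (x v : V) : open U -> bounded_set U -> U x -> v != 0 ->
  exists q : R, [/\ 0 < q, forall t, 0 <= t < q -> U (x + t *: v)
    & ~ U (x + q *: v)].
Proof.
move=> Uopen Ubnd Ux v0.
have [M UM] : exists M : R, forall z, U z -> `|z| <= M.
  have [M HM] := (@ex_bound V R V id _ (globally_properfilter Ux)).1 Ubnd.
  by exists M.
pose S := [set t : R | 0 <= t /\ ~ U (x + t *: v)].
have nv : 0 < `|v| by rewrite normr_gt0.
have S0 : S !=set0.
  (* At this time the displacement has norm [|M| + |x| + 1], so the point has norm greater than
     [M]. *)
  exists ((`|M| + `|x| + 1) / `|v|); split.
    by rewrite divr_ge0 // !addr_ge0.
  move=> /UM; apply/negP; rewrite -ltNge.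
  have : `|((`|M| + `|x| + 1) / `|v|) *: v| = `|M| + `|x| + 1.
    rewrite normrZ ger0_norm ?divr_ge0 ?addr_ge0 //.
    by rewrite divfK // gt_eqF.
  set z := _ *: v => zE.
  have := lerB_normD z x; rewrite zE [z + x]addrC.
  by have := ler_norm M; lra.
have lbS : lbound S 0 by move=> t [].
have hinf : has_inf S by split=> //; exists 0.
have q0 : 0 <= inf S by apply: lb_le_inf.
have inU t : 0 <= t < inf S -> U (x + t *: v).
  move=> /andP[t0 tS]; apply: contrapT => nU.
  have : inf S <= t by apply: ge_inf; [exists 0|].
  by rewrite leNgt tS.
have outU : ~ U (x + inf S *: v).
  move=> Uq.
  have /nbhs_ballP[e /= e0 He] : \forall t \near inf S, U (x + t *: v).
    by apply: (@continuous_line _ _ x v (inf S)); exact: open_nbhs_nbhs.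
  have [t St tlt] := inf_adherent e0 hinf.
  have tge : inf S <= t by apply: ge_inf => //; exists 0.
  case: (St) => _; apply; apply: He.
  by rewrite /ball /= distrC ger0_norm ?subr_ge0 // ltrBlDl.
exists (inf S); split=> //.
rewrite lt_neqAle q0 andbT; apply/eqP => qE.
by apply: outU; rewrite -qE scale0r addr0.
Qed.

Lemma boundary_exit_point (R : realType) (V : normedModType R) (C : set V)
    (x v : V) (q : R) : 0 < q -> (forall t, 0 <= t < q -> C° (x + t *: v)) ->
  ~ C° (x + q *: v) -> boundary C (x + q *: v).
Proof.
move=> q0 inC outC; split=> // B nB.
have /nbhs_ballP[e /= e0 He] : \forall t \near q, B (x + t *: v).
  exact: (@continuous_line _ _ x v q).
pose t := Num.max 0 (q - e / 2).
have t0 : 0 <= t by rewrite le_max lexx.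
have tq : t < q by rewrite gt_max q0 /= ltrBlDr ltrDl divr_gt0.
exists (x + t *: v); split; first by apply: interior_subset; apply: inC; rewrite t0.
apply: He; rewrite /ball /= ger0_norm ?subr_ge0 ?(ltW tq) //.
have : q - e / 2 <= t by rewrite le_max lexx orbT.
lra.
Qed.

Lemma is_derive_line (R : realType) (V : normedModType R) (h : V -> R)
    (x v : V) (t : R) : differentiable h (x + t *: v) ->
  is_derive t 1 (fun r => h (x + r *: v)) ('d h (x + t *: v) v).
Proof.
move=> hd; rewrite -deriveE //.
have : is_derive (x + t *: v) v h ('D_v h (x + t *: v)).
  by apply: DeriveDef => //; exact: diff_derivable.
have shiftE : (fun k : R => k^-1 *: ((h \o shift (x + t *: v)) (k *: v)
      - h (x + t *: v)))
    = (fun k : R => k^-1 *: (((fun r : R => h (x + r *: v)) \o shift t) (k *: 1)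
      - h (x + t *: v))).
  apply/funext => k; congr (_ *: (h _ - _)).
  by rewrite /= [k *: 1]mulr1 scalerDl addrCA.
case=> cv lv; split; first by rewrite /derivable -shiftE.
by rewrite /derive -shiftE.
Qed.

Lemma cvg_boundary_line (R : realType) (V : normedModType R) (C : set V)
    (f : V -> R) (x v : V) (q M : R) :
  (forall t, 0 <= t < q -> C° (x + t *: v)) ->
  f z @[z --> within C° (nbhs (x + q *: v))] --> +oo ->
  exists2 t0, t0 < q & forall t, 0 <= t -> t0 < t < q -> M < f (x + t *: v).
Proof.
move=> inC /cvgryPgt /(_ M) fM.
have /nbhs_ballP[e /= e0 He] :
    \forall t \near q, C° (x + t *: v) -> M < f (x + t *: v).
  exact: (@continuous_line _ _ x v q _ fM).
exists (q - e); first by rewrite ltrBlDr ltrDl.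
move=> t t0 /andP[et tq]; apply: He; last by apply: inC; rewrite t0.
by rewrite /ball /= ger0_norm ?subr_ge0 ?(ltW tq) // ltrBlDr -ltrBlDl.
Qed.

(** * Exit-time bounds for a barrier *)

Lemma powR_three_halves (R : realType) (x : R) : 0 <= x ->
  x `^ (3 / 2) = Num.sqrt x ^+ 3.
Proof.
move=> x0; rewrite mulrC powRrM powR12_sqrt // -powR_mulrn ?sqrtr_ge0 //.
Qed.

Lemma barrier_gammaE (R : realType) (nu : R) : 1 < nu ->
  barrier_gamma nu = Num.sqrt (nu - 1) - (Num.sqrt (nu - 1))^-1.
Proof.
move=> nu1; rewrite /barrier_gamma; set be := Num.sqrt _.
have be0 : 0 < be by rewrite sqrtr_gt0 subr_gt0.
have -> : nu - 2 = be ^+ 2 - 1 by rewrite sqr_sqrtr ?subr_ge0 ?ltW //; ring.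
by field; rewrite gt_eqF.
Qed.

(** The restriction of [f] to the line supplies the data of the Riccati section; blow-up of [f] at
    the exit point makes [u = exp (- f)] tend to 0. *)
Lemma barrier_exit_bound (R : realType) (n : nat) (nu : R)
    (C : set 'rV[R]_n) (f : 'rV[R]_n -> R) (x v : 'rV[R]_n) (q : R) :
  2 <= nu -> barrier_conditions nu C f -> v != 0 ->
  0 < q -> (forall t, 0 <= t < q -> C° (x + t *: v)) -> ~ C° (x + q *: v) ->
  let s := Num.sqrt (D2 f x v v - D1 f x v ^+ 2) in
  s / Num.sqrt (nu - 1) <= q^-1 - D1 f x v <= Num.sqrt (nu - 1) * s.
Proof.
move=> nu2 [[fd f'd] fpos fbd fself] v0 q0 inC outC /=.
have be0 : 0 < Num.sqrt (nu - 1) by rewrite sqrtr_gt0; lra.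
have gam0 : 0 <= barrier_gamma nu by rewrite divr_ge0 ?sqrtr_ge0 ?subr_ge0.
have gE : barrier_gamma nu = Num.sqrt (nu - 1) - (Num.sqrt (nu - 1))^-1.
  by apply: barrier_gammaE; lra.
pose a (t : R) := D1 f (x + t *: v) v.
pose b (t : R) := D2 f (x + t *: v) v v.
pose c (t : R) := D3 f (x + t *: v) v v v.
pose s (t : R) := Num.sqrt (b t - a t * a t).
(* Normalised so that [s' = 2 * a * s + e * s ^+ 2]; the third barrier condition becomes
   [|e| <= barrier_gamma nu]. *)
pose e (t : R) := (c t - 6 * b t * a t + 4 * a t ^+ 3) / (2 * s t ^+ 3).
pose u (t : R) := expR (- f (x + t *: v)).
have pos (t : R) : 0 <= t < q -> 0 < b t - a t * a t.
  by move=> tq; exact: (fpos _ (inC t tq) v v0).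
have s0 (t : R) : 0 <= t < q -> 0 < s t by move=> tq; rewrite sqrtr_gt0 pos.
have sE (t : R) : 0 <= t < q -> s t ^+ 2 + a t ^+ 2 = b t.
  by move=> tq; rewrite (sqr_sqrtr (ltW (pos t tq))) expr2 subrK.
have da (t : R) : 0 <= t < q -> is_derive t 1 a (b t).
  by move=> tq; apply: is_derive_line; apply: (f'd v).1; exact: inC.
have db (t : R) : 0 <= t < q -> is_derive t 1 b (c t).
  by move=> tq; apply: is_derive_line; apply: ((f'd v).2 v).1; exact: inC.
have eb (t : R) : 0 <= t < q -> `|e t| <= barrier_gamma nu.
  move=> tq; have st := s0 t tq; rewrite /e normrM normfV.
  have s30 : 0 < 2 * s t ^+ 3 by rewrite mulr_gt0 // exprn_gt0.
  rewrite [`|2 * _|]gtr0_norm // ler_pdivrMr //.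
  apply: (le_trans (fself _ (inC t tq) v)).
  have pt := pos t tq; rewrite powR_three_halves -/(a t) -/(b t) expr2 ?(ltW pt) //.
  by rewrite -/(s t) le_eqVlt; apply/orP; left; apply/eqP; ring.
have ds (t : R) : 0 <= t < q -> is_derive t 1 s (2 * a t * s t + e t * s t ^+ 2).
  move=> tq; have st := s0 t tq.
  have dbaa := is_derive_fun_add (db t tq)
    (is_derive_fun_opp (is_derive_fun_mul (da t tq) (da t tq))).
  have dsqrt : is_derive t 1 s
      ((2 * s t)^-1 * (c t - (b t * a t + a t * b t))).
    exact: (is_derive_fun_sqrt (f := fun r => b r - a r * a r) (pos t tq) dbaa).
  apply: (is_derive_fun_eq dsqrt).
  have identity (A B C' S : R) : S != 0 -> B = S ^+ 2 + A ^+ 2 ->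
      (2 * S)^-1 * (C' - (B * A + A * B))
      = 2 * A * S + (C' - 6 * B * A + 4 * A ^+ 3) / (2 * S ^+ 3) * S ^+ 2.
    by move=> S0 ->; field.
  by apply: identity; [rewrite gt_eqF|rewrite sE].
have du (t : R) : 0 <= t < q -> is_derive t 1 u (- a t * u t).
  move=> tq; have dg : is_derive t 1 (fun r => f (x + r *: v)) (a t).
    by apply: is_derive_line; apply: fd; exact: inC.
  apply: (is_derive_fun_eq (is_derive_fun_exp (is_derive_fun_opp dg))).
  by rewrite mulrC.
have u_to0 (eps : R) : 0 < eps ->
    exists2 t0, t0 < q & forall t, t0 < t < q -> u t < eps.
  move=> eps0.
  have [t0 t0q Ht0] := cvg_boundary_line (- ln eps) inC
    (fbd _ (boundary_exit_point q0 inC outC)).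
  (* [cvg_boundary_line] speaks of nonnegative times only, hence the maximum. *)
  exists (Num.max 0 t0) => [|t]; first by rewrite gt_max q0.
  rewrite gt_max => /andP[/andP[t_gt0 tt0] tq].
  rewrite /u -[ltRHS]lnK ?posrE // ltr_expR ltrNl.
  by apply: Ht0; rewrite ?tt0 // ltW.
have da' (t : R) : 0 <= t < q -> is_derive t 1 a (s t ^+ 2 + a t ^+ 2).
  by move=> tq; rewrite sE //; exact: da.
have := riccati_exit_bounds gam0 q0 s0 (fun t _ => expR_gt0 _) eb da' ds du
  u_to0 be0 gE.
by rewrite /s /a /b scale0r addr0 -expr2.
Qed.

(** * Derivatives of linear combinations on an open set *)

(** The first-order expansion of [f] at [x] is also one of [g], and the differential is unique. This
    is needed because [fc] is prescribed on the interior of [C] only. *)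
Lemma near_eq_diff (R : numFieldType) (V W : normedModType R) (f g : V -> W)
    (x : V) : (\near x, f x = g x) -> differentiable f x ->
  differentiable g x /\ 'd g x = 'd f x :> (V -> W).
Proof.
move=> fg fdiff.
have expansion : g \o shift x = cst (g x) + 'd f x +o_ 0 id.
  apply/eqaddoP => e e0.
  have /eqaddoP /(_ e e0) := diff_locally fdiff.
  have fg0 : \forall h \near 0, f (h + x) = g (h + x).
    by move: fg; rewrite (near_shift 0) subr0.
  apply: filter_app; near=> h.
  have fgh : f (h + x) = g (h + x) by near: h.
  by rewrite /= -![(_ + _ : _ -> _) _]/(_ + _) -![(- _ : _ -> _) _]/(- _)
    -![(_ + _ : _ -> _) _]/(_ + _) /= fgh /cst (nbhs_singleton fg).
have dE := diff_unique (diff_continuous fdiff) expansion.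
split=> //; apply/diff_locallyP; rewrite dE; split=> //.
exact: diff_continuous.
Unshelve. all: by end_near. Qed.

Section linear_combination.
Context {R : realType} {n k : nat} (U : set 'rV[R]_n) (lambda : 'I_k -> R).
Implicit Types (f : 'I_k -> 'rV[R]_n -> R) (g : 'rV[R]_n -> R).
Hypothesis U_open : open U.

Lemma D1_lincomb f g : (forall i x, U x -> differentiable (f i) x) ->
  (forall x, U x -> g x = \sum_i lambda i * f i x) ->
  forall x, U x -> differentiable g x /\
    forall v, D1 g x v = \sum_i lambda i * D1 (f i) x v.
Proof.
move=> fd gE x Ux.
pose h : 'rV[R]_n -> R := \sum_i (lambda i *: f i).
have hE z : h z = \sum_i lambda i * f i z by rewrite /h fct_sumE.
have hg : \near x, h x = g x.
  by apply: (@filterS _ _ (nbhs_filter x) U) => [z Uz|];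
    [rewrite hE gE|exact: open_nbhs_nbhs].
have hd : differentiable h x.
  by apply: differentiable_sum => i; apply: differentiableZ; exact: fd.
have [gd dE] := near_eq_diff hg hd.
split=> // v; rewrite /D1 dE -deriveE // /h derive_sum; last first.
  by move=> i; apply/diff_derivable/differentiableZ/fd.
apply: eq_bigr => i _; rewrite deriveZ; last exact/diff_derivable/fd.
by rewrite deriveE //; exact: fd.
Qed.

(** Induction on [m]: by [D1_lincomb] each [D1 g ^~ v] is on [U] the same combination of the
    [D1 (f i) ^~ v]. *)
Lemma Ck_lincomb m f g : (forall i, Ck m U (f i)) ->
  (forall x, U x -> g x = \sum_i lambda i * f i x) -> Ck m U g.
Proof.
elim: m f g => [|m IH] f g /= fC gE.
  move=> x Ux.
  have fc i : (fun z => lambda i * f i z) @ x --> lambda i * f i x.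
    by apply: (@cvgMl_tmp _ _ (nbhs x) _); exact: fC.
  have hc := cvg_big (@add_continuous R) (r := index_enum 'I_k) (P := predT)
    (x0 := 0) (nbhs_filter x) (fun i _ => fc i).
  have gf : {near x, (fun z => \sum_i lambda i * f i z) =1 g}.
    by apply: filterS (open_nbhs_nbhs (conj U_open Ux)) => z Uz; rewrite gE.
  rewrite /prop_for /continuous_at (gE _ Ux).
  exact: cvg_trans (near_eq_cvg gf) hc.
have lin := D1_lincomb (fun i => (fC i).1) gE.
split=> [x /lin[]//|v].
apply: (IH (fun i => D1 (f i) ^~ v)) => [i|x Ux]; first exact: (fC i).2.
exact: (lin x Ux).2.
Qed.

End linear_combination.

(** * Finite convex combinations *)

(** Split off the first point and renormalise the other weights by their sum [mu]; if [mu = 0], only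
    the first point remains. *)
Lemma convex_set_sum (R : realType) (V : lmodType R) (A : set V) (k : nat)
    (lambda : 'I_k -> R) (P : 'I_k -> V) : convex_set A ->
  (forall i, A (P i)) -> (forall i, 0 <= lambda i) ->
  \sum_(i < k) lambda i = 1 -> A (\sum_(i < k) lambda i *: P i).
Proof.
move=> Aconv; elim: k lambda P => [|k IH] lambda P AP l0.
  by rewrite big_ord0 => /eqP; rewrite eq_sym oner_eq0.
rewrite !big_ord_recl; set mu := \sum_(i < k) _ => lmu.
have mu0 : 0 <= mu by apply: sumr_ge0.
have [muE|muN0] := eqVneq mu 0.
  rewrite big1 => [|i _].
    have -> : lambda ord0 = 1 by move: lmu; rewrite muE addr0.
    by rewrite scale1r addr0.
  have /eqP := muE; rewrite psumr_eq0 // => /allP /(_ i).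
  by rewrite mem_index_enum => /(_ isT) /eqP ->; rewrite scale0r.
have mu_gt0 : 0 < mu by rewrite lt_neqAle eq_sym muN0.
pose W := \sum_(i < k) (lambda (lift ord0 i) / mu) *: P (lift ord0 i).
have AW : A W.
  apply: IH => // [i|]; first by rewrite divr_ge0.
  by rewrite -mulr_suml divff.
have l1 : lambda ord0 <= 1 by rewrite -lmu lerDl.
have := Aconv (P ord0) W (Itv01 (l0 ord0) l1) (mem_set (AP ord0)) (mem_set AW).
move/set_mem; congr A; rewrite /conv /=.
congr (_ + _); rewrite /W scaler_sumr; apply: eq_bigr => i _.
have -> : unstable.onem (lambda ord0) = mu
  by rewrite /unstable.onem -lmu addrC addKr.
by rewrite scalerA mulrC divfK.
Qed.

Lemma convex_hull_sum (R : realType) (V : lmodType R) (A : set V) (k : nat)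
    (lambda : 'I_k -> R) (P : 'I_k -> V) :
  (forall i, A (P i)) -> (forall i, 0 <= lambda i) ->
  \sum_(i < k) lambda i = 1 -> convex_hull A (\sum_(i < k) lambda i *: P i).
Proof.
move=> AP l0 l1 M [Mconv AM]; apply: convex_set_sum => // i.
exact/AM/AP.
Qed.

(** * Jets under a projective change of parameter *)

(* The first three derivatives at z = 0 of g (t z / (1 + c z)) - ln (1 + c z),
   where a, b, c3 are those of g at 0. *)
Definition projective_jet {R : realType} (t c a b c3 : R) : 'rV[R]_3 :=
  \row_j nth 0 [:: t * a - c; t ^+ 2 * b - 2 * (t * c) * a + c ^+ 2;
    t ^+ 3 * c3 - 6 * (c * t ^+ 2) * b + 6 * (t * c ^+ 2) * a - 2 * c ^+ 3] j.

(** For fixed [t] and [c] the jet is affine in [(a, b, c3)]; its constant terms survive because the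
    weights sum to 1. *)
Lemma projective_jet_sum (R : realType) (k : nat) (lambda : 'I_k -> R)
    (t c : R) (a b c3 : 'I_k -> R) : \sum_i lambda i = 1 ->
  \sum_i lambda i *: projective_jet t c (a i) (b i) (c3 i) =
  projective_jet t c (\sum_i lambda i * a i) (\sum_i lambda i * b i)
    (\sum_i lambda i * c3 i).
Proof.
move=> l1; apply/rowP => j; rewrite summxE mxE.
have affine (r s w z : R) (F G H : 'I_k -> R) :
    r * (\sum_i lambda i * F i) + s * (\sum_i lambda i * G i)
      + w * (\sum_i lambda i * H i) + z
    = \sum_i lambda i * (r * F i + s * G i + w * H i + z).
  rewrite -[z in LHS]mulr1 -l1 !mulr_sumr -!big_split /=.
  by apply: eq_bigr => i _; ring.
case: j => -[|[|[|//]]] j3 /=.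
- rewrite [RHS](_ : _ = t * (\sum_i lambda i * a i) + 0 * (\sum_i lambda i * a i)
    + 0 * (\sum_i lambda i * a i) + (- c)); last by ring.
  by rewrite affine; apply: eq_bigr => i _; rewrite !mxE /=; ring.
- rewrite [RHS](_ : _ = t ^+ 2 * (\sum_i lambda i * b i)
    + (- (2 * (t * c))) * (\sum_i lambda i * a i)
    + 0 * (\sum_i lambda i * a i) + c ^+ 2); last by ring.
  by rewrite affine; apply: eq_bigr => i _; rewrite !mxE /=; ring.
- rewrite [RHS](_ : _ = t ^+ 3 * (\sum_i lambda i * c3 i)
    + (- (6 * (c * t ^+ 2))) * (\sum_i lambda i * b i)
    + (6 * (t * c ^+ 2)) * (\sum_i lambda i * a i) + (- (2 * c ^+ 3))); last by ring.
  by rewrite affine; apply: eq_bigr => i _; rewrite !mxE /=; ring.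
Qed.

(** The change of parameter multiplies [s] by [t] and the cubic expression by [t ^+ 3], so powers of
    [t] cancel. The parameters 1 and -1 correspond to the times [t / (1 + c)] and [- t / (1 - c)],
    whose reciprocals appear in the two bounds. *)
Lemma Pset_projective_jet (R : realType) (nu t c a b c3 : R) : 0 < t ->
  let s := Num.sqrt (b - a ^+ 2) in
  Pset nu (projective_jet t c a b c3) <->
  [/\ a ^+ 2 <= b,
      s / Num.sqrt (nu - 1) <= (1 - c) / t + a <= Num.sqrt (nu - 1) * s,
      s / Num.sqrt (nu - 1) <= (1 + c) / t - a <= Num.sqrt (nu - 1) * s
    & `|c3 - 6 * b * a + 4 * a ^+ 3| <= 2 * barrier_gamma nu * s ^+ 3].
Proof.
move=> t0 s; rewrite /Pset /= !mxE /= /barrier_gamma.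
set be := Num.sqrt (nu - 1).
have tn0 : t != 0 by rewrite gt_eqF.
have varE : t ^+ 2 * b - 2 * (t * c) * a + c ^+ 2 - (t * a - c) ^+ 2
  = t ^+ 2 * (b - a ^+ 2) by ring.
have first_conj : ((t * a - c) ^+ 2 <= t ^+ 2 * b - 2 * (t * c) * a + c ^+ 2)
    = (a ^+ 2 <= b).
  by rewrite -subr_ge0 varE pmulr_rge0 ?exprn_gt0 // subr_ge0.
have sE : Num.sqrt (t ^+ 2 * (b - a ^+ 2)) = t * s.
  by rewrite sqrtrM ?sqr_ge0 // sqrtr_sqr gtr0_norm.
have bounds r : (t * s / be <= t * r <= be * (t * s)) = (s / be <= r <= be * s).
  by rewrite -mulrA (mulrCA be) !ler_pM2l.
have mE : t * a - c + 1 = t * ((1 - c) / t + a) by field.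
have pE : - (t * a - c) + 1 = t * ((1 + c) / t - a) by field.
have thirdE : t ^+ 3 * c3 - 6 * (c * t ^+ 2) * b + 6 * (t * c ^+ 2) * a - 2 * c ^+ 3
    - 6 * (t ^+ 2 * b - 2 * (t * c) * a + c ^+ 2) * (t * a - c)
    + 4 * (t * a - c) ^+ 3 = t ^+ 3 * (c3 - 6 * b * a + 4 * a ^+ 3) by ring.
have last_conj : a ^+ 2 <= b ->
    (`|t ^+ 3 * (c3 - 6 * b * a + 4 * a ^+ 3)|
      <= 2 * ((nu - 2) / be) * (t ^+ 2 * (b - a ^+ 2)) `^ (3 / 2))
    = (`|c3 - 6 * b * a + 4 * a ^+ 3| <= 2 * ((nu - 2) / be) * s ^+ 3).
  move=> ab; have vpos : 0 <= t ^+ 2 * (b - a ^+ 2).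
    by rewrite mulr_ge0 ?sqr_ge0 ?subr_ge0.
  rewrite (powR_three_halves vpos) sE.
  have t30 : 0 < t ^+ 3 by rewrite exprn_gt0.
  by rewrite normrM (gtr0_norm t30) exprMn [in RHS]mulrC [leRHS]mulrCA ler_pM2l // mulrC.
rewrite first_conj varE sE mE pE thirdE !bounds.
by split=> -[ab h1 h2 h3]; split=> //; move: h3; rewrite last_conj.
Qed.

(** * Transfer to the convex combination *)

Lemma D1N (R : realType) (n : nat) (f : 'rV[R]_n -> R) (x v : 'rV[R]_n) :
  D1 f x (- v) = - D1 f x v.
Proof. exact: raddfN. Qed.

Lemma D2NN (R : realType) (n : nat) (f : 'rV[R]_n -> R) (x v : 'rV[R]_n) :
  differentiable (D1 f ^~ v) x -> D2 f x (- v) (- v) = D2 f x v v.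
Proof.
move=> fd.
have D1fN : D1 f ^~ (- v) = - (D1 f ^~ v) by apply/funext => y; exact: D1N.
have -> : D2 f x (- v) (- v) = - D2 f x (- v) v by exact: raddfN.
have -> : D2 f x (- v) v = - D2 f x v v; last exact: opprK.
by rewrite /D2 D1fN (diffN fd).
Qed.

(* Every f i sees the same two exit times, hence their jets in the common
   projective parameter all lie in Pset nu, and that of fc in its hull. *)
Lemma convex_combination_jet (R : realType) (n k : nat) (nu nu' : R)
    (C : set 'rV[R]_n) (f : 'I_k -> 'rV[R]_n -> R) (lambda : 'I_k -> R)
    (x v : 'rV[R]_n) :
  2 <= nu -> 2 <= nu' -> compact C ->
  (forall i, barrier_conditions nu C (f i)) ->
  (forall i, 0 <= lambda i) -> \sum_i lambda i = 1 ->
  convex_hull (Pset nu) `<=` Pset nu' -> C° x -> v != 0 ->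
  let a := \sum_i lambda i * D1 (f i) x v in
  let b := \sum_i lambda i * D2 (f i) x v v in
  let c3 := \sum_i lambda i * D3 (f i) x v v v in
  a ^+ 2 < b /\ `|c3 - 6 * b * a + 4 * a ^+ 3|
    <= 2 * barrier_gamma nu' * (b - a ^+ 2) `^ (3 / 2).
Proof.
move=> nu2 nu'2 Ccompact fbar l0 l1 hull Cx v0 a b c3.
have Cbnd : bounded_set C°.
  have [M CM] := (@ex_bound _ R 'rV[R]_n id _
    (globally_properfilter (interior_subset Cx))).1 (compact_bounded Ccompact).
  apply/(@ex_bound _ R 'rV[R]_n id _ (globally_properfilter Cx)); exists M.
  by move=> z /interior_subset; exact: CM.
have nv0 : - v != 0 by rewrite oppr_eq0.
have [q [q0 inq outq]] := exit_time_exists (@open_interior _ C) Cbnd Cx v0.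
have [p [p0 inp outp]] := exit_time_exists (@open_interior _ C) Cbnd Cx nv0.
have sum0 : 0 < p^-1 + q^-1 by rewrite addr_gt0 ?invr_gt0.
(* Solves [(1 + c) / t = q^-1] and [(1 - c) / t = p^-1]: the exit times [q] and [- p] move to 1 and
   -1. *)
pose t := 2 / (p^-1 + q^-1); pose c := t / q - 1.
have t0 : 0 < t by rewrite divr_gt0.
have qE : (1 + c) / t = q^-1.
  by rewrite /c; field; rewrite !gt_eqF.
have pE : (1 - c) / t = p^-1.
  have -> : p^-1 = 2 / t - q^-1 by rewrite /t invf_div mulrCA divff ?mulr1 ?addrK.
  by rewrite /c; field; rewrite !gt_eqF.
have jet_i i : Pset nu (projective_jet t c (D1 (f i) x v) (D2 (f i) x v v)
    (D3 (f i) x v v v)).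
  have [fC fpos _ fself] := fbar i.
  have vpos := fpos x Cx v v0.
  have fd : differentiable (D1 (f i) ^~ v) x by apply: (fC.2 v).1.
  apply/(Pset_projective_jet nu c _ _ _ t0); rewrite qE pE; split.
  - by rewrite -subr_ge0 ltW.
  (* The time [p] belongs to the direction [- v], which flips the sign of [D1] and preserves
     [D2]. *)
  - have := barrier_exit_bound nu2 (fbar i) nv0 p0 inp outp.
    by rewrite /= D2NN // D1N sqrrN opprK.
  - exact: barrier_exit_bound nu2 (fbar i) v0 q0 inq outq.
  - by rewrite -powR_three_halves ?fself // ltW.
have jet_c : Pset nu' (projective_jet t c a b c3).
  have hull_c := convex_hull_sum jet_i l0 l1.
  by apply: hull; rewrite (projective_jet_sum t c _ _ _ l1) in hull_c.
have [ab /andP[_ h1] /andP[_ h2] h3] :=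
  (Pset_projective_jet nu' c a b c3 t0).1 jet_c.
split; last by rewrite powR_three_halves // subr_ge0.
(* Equality would make [s] vanish, and the upper bounds would give [p^-1 + a <= 0] and
   [q^-1 - a <= 0], against [p^-1 + q^-1 > 0]. *)
rewrite lt_neqAle ab andbT; apply/eqP => abE.
move: h1 h2; rewrite abE subrr sqrtr0 mulr0 qE pE; lra.
Qed.

Theorem corollary2 (R : realType) (n k : nat) (nu nu' : R)
    (C : set 'rV[R]_n) (f : 'I_k -> 'rV[R]_n -> R) (fc : 'rV[R]_n -> R)
    (nu_ge2 : 2 <= nu) (nu'_ge2 : 2 <= nu')
    (C_compact : compact C) (C_convex : @convex_set R 'rV[R]_n C)
    (f_barrier : forall i, barrier_conditions nu C (f i))
    (fc_comb : convex_combination_on C° f fc)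
    (hull_sub : convex_hull (Pset nu) `<=` Pset nu') :
  barrier_conditions nu' C fc.
Proof.
have [lambda [l0 l1 fcE]] := fc_comb.
have Copen : open C° by exact: open_interior.
have lin1 := D1_lincomb Copen
  (fun i => let: And4 fC _ _ _ := f_barrier i in fC.1) fcE.
have lin2 v := D1_lincomb Copen
  (fun i => let: And4 fC _ _ _ := f_barrier i in (fC.2 v).1)
  (fun x Cx => (lin1 x Cx).2 v).
have lin3 v w := D1_lincomb Copen
  (fun i => let: And4 fC _ _ _ := f_barrier i in ((fC.2 v).2 w).1)
  (fun x Cx => (lin2 v x Cx).2 w).
have jet x v (Cx : C° x) (v0 : v != 0) := convex_combination_jet nu_ge2
  nu'_ge2 C_compact f_barrier l0 l1 hull_sub Cx v0.
have D1E x v : C° x -> D1 fc x v = \sum_i lambda i * D1 (f i) x v.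
  by move=> Cx; exact: (lin1 x Cx).2.
have D2E x v : C° x -> D2 fc x v v = \sum_i lambda i * D2 (f i) x v v.
  by move=> Cx; exact: (lin2 v x Cx).2.
have D3E x v : C° x -> D3 fc x v v v = \sum_i lambda i * D3 (f i) x v v v.
  by move=> Cx; exact: (lin3 v v x Cx).2.
split.
- by apply: (Ck_lincomb Copen _ fcE) => i; case: (f_barrier i).
- move=> x Cx v v0; rewrite D1E // D2E // subr_gt0 -expr2.
  by case: (jet x v Cx v0).
- move=> p Cp; apply/cvgryPge => M.
  have fM : \forall x \near within C° (nbhs p), forall i, M <= f i x.
    by apply: filter_forall => i; have [_ _ /(_ p Cp)/cvgryPge] := f_barrier i.
  have inC : \forall x \near within C° (nbhs p), C° x by exact: withinT.
  apply: filterS2 inC fM => x Cx fM.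
  (* As the weights sum to 1, [M] is itself the combination of copies of [M]. *)
  rewrite fcE // -[M]mul1r -l1 mulr_suml; apply: ler_sum => i _.
  by rewrite ler_wpM2l.
(* The zero direction never leaves the interior, so it is treated apart: the left-hand side is then
   0. *)
- move=> x Cx v; have [->|v0] := eqVneq v 0; last first.
    by rewrite D1E // D2E // D3E //; case: (jet x v Cx v0).
  rewrite /D3 {1}/D2 /D1 !linear0 !mulr0 expr0n /= mulr0 !subr0 addr0 normr0.
  by rewrite mulr_ge0 ?powR_ge0 // mulr_ge0 // divr_ge0 ?sqrtr_ge0 ?subr_ge0.
Qed.
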